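(* For $n\in\mathbb N$ let $b(n)=\lceil\log n\rceil$. For a function $f_n:\{0,1\}^{n\cdot b(n)}\to\{0,1\}^{n\cdot b(n)}$ and $i\in[n]$ define $f_{n,i}:\{0,1\}^{n\cdot b(n)}\to\{0,1\}^{b(n)}$ by $f_{n,i}(x)=f_n(x)_{i b(n),\,i b(n)+1,\dots,(i+1)b(n)-1}$, i.e., the $(i+1)$-st consecutive block of $b(n)$ output bits. If there is a family $\{C_n\}_{n\in\mathbb N}$ of boolean circuits (with constant fan-in gates) of size $O(n\log n)$ and depth $O(\log n)$, where $C_n$ computes $f_n:\{0,1\}^{n\cdot b(n)}\to\{0,1\}^{n\cdot b(n)}$, then for every constant $\varepsilon>0$ there is a family of non-adaptive data structures $\{\mathcal D_n\}_{n\in\mathbb N}$ such that $\mathcal D_n$, on input $x\in\{0,1\}^{n\cdot b(n)}$, uses $O(n\log n/\log\log n)$ bits of advice and, on a query $j\in[n]$, outputs $f_{n,j}(x)$ using $O(n^{\varepsilon})$ queries to the input.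
   Context: $[n]=\{0,\dots,n-1\}$. A non-adaptive (systematic, non-uniform) data structure $\mathcal D_n$ consists of a preprocessing algorithm that computes from the input $x$ an advice string, and a query algorithm that on a query $j$ has full access to the advice and reads some input positions, where the set of input positions read depends only on $j$; queries to the input here read blocks of $b(n)$ bits (one of the $n$ input numbers). The algorithms may depend arbitrarily on $n$. *)

(* Defs.v *)
From mathcomp Require Export all_boot all_order all_algebra.
From mathcomp Require Export all_classical all_reals all_analysis.
Export numFieldNormedType.Exports.

Set Implicit Arguments.
Unset Strict Implicit.
Unset Printing Implicit Defensive.

(* A gate computes an arbitrary boolean function [gate_op] of its fan-in.
   Wires are numbered: those of a circuit with m inputs are 0, ..., m - 1 for
   the inputs, then m + i for the output of the i-th gate. *)
Record gate := Gate {
  gate_fanin : nat;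
  gate_src : gate_fanin.-tuple nat;
  gate_op : gate_fanin.-tuple bool -> bool }.

(* The underlying directed acyclic graph is given in topological order:
   the i-th gate may only read inputs and earlier gates. *)
Definition wf_gates (m : nat) (gs : seq gate) : Prop :=
  forall i g, onth gs i = Some g -> all (fun w => w < m + i) (gate_src g).

Record circuit (m k : nat) := Circuit {
  circuit_gates : seq gate;
  circuit_wf : wf_gates m circuit_gates;
  circuit_out : k.-tuple 'I_(m + size circuit_gates) }.

Definition gate_eval (ws : seq bool) (g : gate) : bool :=
  gate_op (map_tuple (nth false ws) (gate_src g)).

(* Given the depths [ds] of the preceding wires; inputs have depth 0. *)
Definition gate_depth (ds : seq nat) (g : gate) : nat :=
  (\max_(w <- gate_src g) nth 0 ds w).+1.

Section Circuit.
Variables m k : nat.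
Implicit Type C : circuit m k.

Definition wire_values C (x : m.-tuple bool) : seq bool :=
  foldl (fun ws g => rcons ws (gate_eval ws g)) x (circuit_gates C).

Definition wire_depths C : seq nat :=
  foldl (fun ds g => rcons ds (gate_depth ds g)) (nseq m 0) (circuit_gates C).

Definition circuit_eval C (x : m.-tuple bool) : k.-tuple bool :=
  [tuple nth false (wire_values C x) (tnth (circuit_out C) i) | i < k].

Definition circuit_size C : nat := size (circuit_gates C).

Definition circuit_depth C : nat :=
  \max_(i < k) nth 0 (wire_depths C) (tnth (circuit_out C) i).

Definition circuit_fanin C : nat :=
  \max_(g <- circuit_gates C) gate_fanin g.

Definition circuit_computes C (f : m.-tuple bool -> k.-tuple bool) : Prop :=
  forall x, circuit_eval C x = f x.
End Circuit.

Definition block (n b : nat) (x : (n * b).-tuple bool) (i : 'I_n) :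
    b.-tuple bool :=
  [tuple nth false x (i * b + k) | k < b].

(* Non-adaptivity: the set [ds_probes j] depends on the query j only. The
   answer is a function of j, the advice and the blocks at these positions. *)
Record data_structure (n b : nat) := DataStructure {
  ds_advice_size : nat;
  ds_preprocess : (n * b).-tuple bool -> ds_advice_size.-tuple bool;
  ds_probes : 'I_n -> {set 'I_n};
  ds_answer : forall j : 'I_n, ds_advice_size.-tuple bool ->
    ({i : 'I_n | i \in ds_probes j} -> b.-tuple bool) -> b.-tuple bool }.

Section DataStructure.
Variables n b : nat.
Implicit Type D : data_structure n b.

Definition ds_query D (x : (n * b).-tuple bool) (j : 'I_n) : b.-tuple bool :=
  ds_answer (ds_preprocess D x) (fun i : {i | i \in ds_probes D j} => block x (val i)).

Definition ds_query_complexity D : nat := \max_(j < n) #|ds_probes D j|.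
End DataStructure.

(* The ceiling of the binary logarithm of n. *)
Definition blog (n : nat) : nat := up_log 2 n.

Definition log2 (R : realType) (x : R) : R := (ln x / ln 2)%R.

(* Main.v *)
Require Import Defs.
From mathcomp Require Import ring zify.

(** Valiant's depth reduction. Write the depths of the wires in a large constant
    base [B]. Along an edge the depth increases, hence the most significant digit
    in which the two ends differ is well defined, and for one of about
    [log D / log B] digit positions [t] (with [D = O(log n)] the depth of the
    circuit) only an [O(1 / log D)] fraction of the gates has an incoming edge whose
    top differing digit is [t]. The advice consists of the values of these gates.
    Along all other edges the depth with digit [t] deleted still increases, and
    that number is at most [2 D / B], so every output bit depends on the advice and
    on at most [F ^ (2 D / B) <= n ^ (eps / 2)] input bits, [F] being the fan-in. *)

Set Implicit Arguments.
Unset Strict Implicit.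
Unset Printing Implicit Defensive.

(** * Sequences built by appending entries computed from the prefix *)

Section FoldlRcons.
Variables (T A : Type) (F : seq T -> A -> T).
Let extend s (gs : seq A) := foldl (fun ws g => rcons ws (F ws g)) s gs.

Lemma take_foldl_rcons s gs : take (size s) (extend s gs) = s.
Proof.
elim: gs s => [|g gs IH] s /=; first by rewrite take_size.
have le_s : size s <= size (rcons s (F s g)) by rewrite size_rcons.
rewrite -(take_takel _ le_s) (IH (rcons s (F s g))).
by rewrite -cats1 take_size_cat.
Qed.

Lemma nth_foldl_rcons_lt x0 s gs i :
  i < size s -> nth x0 (extend s gs) i = nth x0 s i.
Proof. by move=> lt_i; rewrite -{2}(take_foldl_rcons s gs) nth_take. Qed.

Lemma nth_foldl_rcons x0 g0 s gs i : i < size gs ->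
  nth x0 (extend s gs) (size s + i) =
    F (take (size s + i) (extend s gs)) (nth g0 gs i).
Proof.
elim: gs s i => [//|g gs IH] s [_|i lt_i] /=; last first.
  by rewrite addnS -addSn -(size_rcons s (F s g)) IH.
rewrite addn0 (take_foldl_rcons s (g :: gs)).
by rewrite nth_foldl_rcons_lt ?size_rcons // nth_rcons ltnn eqxx.
Qed.
End FoldlRcons.

(** * Deleting a digit of the depth *)

(* For [u < v]: the most significant base-[B] digit in which [u] and [v] differ
   is the one of weight [B ^ t]. *)
Definition top_diff_digit (B t u v : nat) : bool :=
  (u %/ B ^ t.+1 == v %/ B ^ t.+1) && (u %/ B ^ t < v %/ B ^ t).

Definition delete_digit (B t u : nat) : nat :=
  u %/ B ^ t.+1 * B ^ t + u %% B ^ t.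

(** If the parts above digit [t] differ, that of [v] is larger and outweighs any low part, which is
    below [B ^ t]. If they agree, digit [t] must agree too, so the increase lies in the low part,
    which is kept. *)
Lemma delete_digit_ltn B t u v : 0 < B -> u < v ->
  ~~ top_diff_digit B t u v -> delete_digit B t u < delete_digit B t v.
Proof.
move=> B0 uv; have Bt : 0 < B ^ t by rewrite expn_gt0 B0.
have := leq_div2r (B ^ t.+1) (ltnW uv).
rewrite /top_diff_digit /delete_digit leq_eqVlt => /orP[/eqP E|lt_hi _]; last first.
  apply: leq_trans (leq_addr _ _).
  apply: (@leq_trans ((u %/ B ^ t.+1).+1 * B ^ t)).
    by rewrite mulSn addnC ltn_add2r ltn_mod.
  by rewrite leq_mul2r lt_hi orbT.
rewrite E eqxx /= -leqNgt => le_vu; rewrite ltn_add2l.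
have Eq : u %/ B ^ t = v %/ B ^ t.
  by apply/eqP; rewrite eqn_leq le_vu leq_div2r // ltnW.
by move: uv; rewrite {1}(divn_eq u (B ^ t)) {1}(divn_eq v (B ^ t)) Eq ltn_add2l.
Qed.

(** Each of the two summands, multiplied by [B], is at most [D]: the high one becomes a part of [u],
    the low one stays below [B ^ t.+1]. *)
Lemma delete_digit_leq B t u D : 0 < B -> u <= D -> B ^ t.+1 <= D ->
  delete_digit B t u <= (2 * D) %/ B.
Proof.
move=> B0 uD BD; rewrite leq_divRL // /delete_digit mulnDl mul2n -addnn.
apply: leq_add.
  rewrite -mulnA -expnSr; exact: leq_trans (leq_divM _ _) uD.
apply: leq_trans BD; rewrite expnSr leq_mul2r; apply/orP; right.
by rewrite ltnW // ltn_mod expn_gt0 B0.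
Qed.

Lemma top_diff_digit_inj B s t u v :
  top_diff_digit B s u v -> top_diff_digit B t u v -> s = t.
Proof.
wlog lt_st : s t / s < t => [H|].
  by case: (ltngtP s t) => // st hs ht; [exact: H | exact/esym/H].
case/andP=> /eqP E _ /andP[_]; have le_st : s.+1 <= t by [].
by rewrite -(subnKC le_st) expnD !divnMA E ltnn.
Qed.

(** An edge of the circuit is thus charged to at most one digit position. *)
Lemma sum_top_diff_digit B p u v : \sum_(t < p) top_diff_digit B t u v <= 1.
Proof.
case: (pickP (fun t : 'I_p => top_diff_digit B t u v)) => [t Ht|H0].
  rewrite (bigD1 t) //= Ht big1 // => s /negP ns.
  case: (boolP (top_diff_digit _ _ _ _)) => // Hs; case: ns.
  by apply/eqP/val_inj; exact: top_diff_digit_inj Hs Ht.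
by rewrite big1 // => t _; rewrite H0.
Qed.

Lemma has_leq_sum (T : Type) (a : pred T) s : has a s <= \sum_(x <- s) a x.
Proof.
elim: s => [|x s IH] //=; rewrite big_cons; case: (a x) => //=; exact: leq_trans.
Qed.

(** * Wires of a circuit *)

(** Serves as a default for [nth]; its fan-in 0 keeps the fan-in bound valid outside the circuit. *)
Definition const_gate : gate := @Gate 0 [tuple] (fun=> false).

Section Wires.
Variables (m k : nat) (C : circuit m k).

Definition gate_of (w : nat) : gate := nth const_gate (circuit_gates C) (w - m).
Definition wire_value (x : m.-tuple bool) (w : nat) : bool :=
  nth false (wire_values C x) w.
Definition wire_depth (w : nat) : nat := nth 0 (wire_depths C) w.

Lemma gate_of_src_ltn w u : m <= w -> w < m + circuit_size C ->
  u \in tval (gate_src (gate_of w)) -> u < w.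
Proof.
move=> mw wS; have lt_i : w - m < size (circuit_gates C) by rewrite ltn_subLR.
have := @circuit_wf _ _ C (w - m) (gate_of w).
rewrite subnKC // => H; have /H/allP : onth (circuit_gates C) (w - m) = Some (gate_of w).
  by rewrite onthE (nth_map const_gate).
by apply.
Qed.

Lemma gate_fanin_leq w : gate_fanin (gate_of w) <= circuit_fanin C.
Proof.
rewrite /gate_of; case: (ltnP (w - m) (size (circuit_gates C))) => [lt_i|le_i].
  rewrite /circuit_fanin (big_nth const_gate) big_mkord.
  exact: (leq_bigmax (Ordinal lt_i)).
by rewrite nth_default.
Qed.

Lemma wire_value_input x w : w < m -> wire_value x w = nth false x w.
Proof. by move=> wm; rewrite /wire_value nth_foldl_rcons_lt ?size_tuple. Qed.

Lemma eq_wire_value x x' w : m <= w -> w < m + circuit_size C ->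
  (forall u, u \in tval (gate_src (gate_of w)) -> wire_value x u = wire_value x' u) ->
  wire_value x w = wire_value x' w.
Proof.
move=> mw wS H; have lt_i : w - m < size (circuit_gates C) by rewrite ltn_subLR.
have E y : wire_value y w = gate_op (map_tuple (wire_value y) (gate_src (gate_of w))).
  have := nth_foldl_rcons gate_eval false const_gate y lt_i.
  rewrite size_tuple subnKC // /wire_value => ->; rewrite /gate_eval -/(gate_of w).
  congr gate_op; apply/val_inj/eq_in_map => u usrc.
  by rewrite nth_take // gate_of_src_ltn.
rewrite !E; congr gate_op; apply/val_inj/eq_in_map => u; exact: H.
Qed.

Lemma wire_depth_ltn w u : m <= w -> w < m + circuit_size C ->
  u \in tval (gate_src (gate_of w)) -> wire_depth u < wire_depth w.
Proof.
move=> mw wS usrc; have lt_i : w - m < size (circuit_gates C) by rewrite ltn_subLR.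
have := nth_foldl_rcons gate_depth 0 const_gate (nseq m 0) lt_i.
rewrite size_nseq subnKC // {2}/wire_depth => ->; rewrite /gate_depth ltnS.
have -> : wire_depth u = nth 0 (take w (wire_depths C)) u.
  by rewrite nth_take // gate_of_src_ltn.
apply: (@leq_bigmax_seq _ _ xpredT (fun v => nth 0 (take w (wire_depths C)) v)) => //.
Qed.

(** * Cutting the gates that change a given digit of the depth first *)

Section Cut.
Variables B t : nat.

Definition cut : {set 'I_(circuit_size C)} :=
  [set i | has (fun u => top_diff_digit B t (wire_depth u) (wire_depth (m + val i)))
             (gate_src (gate_of (m + val i)))].

(* Inputs reachable backwards from the wire [w] in at most [h] steps without
   traversing a gate in [cut]. *)
Fixpoint uncut_inputs (h w : nat) : seq nat :=
  if w < m then [:: w] else if h is h'.+1 then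
    if has (fun i => m + val i == w) (enum cut) then [::]
    else flatten [seq uncut_inputs h' u | u <- gate_src (gate_of w)]
  else [::].

Lemma size_uncut_inputs F h w : 0 < F -> circuit_fanin C <= F ->
  size (uncut_inputs h w) <= F ^ h.
Proof.
move=> F0 CF; elim: h w => [|h IH] w /=; first by case: ifP.
case: ifP => _; first by rewrite expn_gt0 F0.
case: ifP => // _; rewrite size_flatten /shape -map_comp sumnE big_map.
apply: leq_trans (_ : \sum_(u <- gate_src (gate_of w)) F ^ h <= _).
  by apply: leq_sum => u _; exact: IH.
rewrite big_const_seq count_predT iter_addn_0 size_tuple expnSr leq_mul2l.
by rewrite (leq_trans (gate_fanin_leq w) CF) orbT.
Qed.

Lemma uncut_inputs_ltn h w i : i \in uncut_inputs h w -> i < m.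
Proof.
elim: h w => [|h IH] w /=; case: ifP => [wm|_] //.
- by rewrite inE => /eqP ->.
- by rewrite inE => /eqP ->.
case: ifP => // _ /flattenP[s /mapP[u _ ->]]; exact: IH.
Qed.

(** The digit-deleted depth is a potential: the sources of an uncut gate have strictly smaller
    potential, so [h] backward steps suffice and induction on [h] applies. *)
Lemma wire_value_determined h x x' w : 0 < B -> w < m + circuit_size C ->
  delete_digit B t (wire_depth w) <= h ->
  (forall i, i \in cut -> wire_value x (m + val i) = wire_value x' (m + val i)) ->
  (forall i, i \in uncut_inputs h w -> nth false x i = nth false x' i) ->
  wire_value x w = wire_value x' w.
Proof.
move=> B0 + + Hcut; elim: h w => [|h IH] w wS wh;
  (have [wm|mw] := ltnP w m; first by move=> H; rewrite !wire_value_input // H //= wm inE).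
all: have /negP mwN : ~~ (w < m) by rewrite -leqNgt.
all: rewrite /= (introF idP mwN).
all: have lt_i : w - m < circuit_size C by rewrite ltn_subLR.
all: have Ew : m + val (Ordinal lt_i) = w by rewrite /= subnKC.
all: have [/Hcut|ncut] := boolP (Ordinal lt_i \in cut); first by rewrite Ew.
all: have rank u : u \in tval (gate_src (gate_of w)) ->
    delete_digit B t (wire_depth u) < delete_digit B t (wire_depth w).
all: try by move=> usrc; apply: delete_digit_ltn => //; [exact: wire_depth_ltn |
    move: ncut; rewrite inE Ew => /hasPn; apply].
(* At potential 0 an uncut gate has no sources, so its value is constant. *)
- move=> _; apply: eq_wire_value => // u /rank; move: wh.
  by rewrite leqn0 => /eqP ->.
have -> : has (fun i => m + val i == w) (enum cut) = false.
  apply/negbTE/hasPn => i; rewrite mem_enum => icut; apply: contra ncut => /eqP Ei.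
  by rewrite (_ : Ordinal lt_i = i) //; apply/val_inj; rewrite /= -Ei addKn.
move=> H; apply: eq_wire_value => // u usrc; apply: IH => //.
- exact: ltn_trans (gate_of_src_ltn mw wS usrc) wS.
- by rewrite -ltnS; apply: leq_trans wh; exact: rank.
- by move=> i iu; apply/H/flattenP; exists (uncut_inputs h u) => //; exact: map_f.
Qed.
End Cut.

(** Double counting: a gate enters [cut B t] only through an edge charged to [t], and each edge is
    charged at most once. *)
Lemma sum_card_cut B p : \sum_(t < p) #|cut B t| <= circuit_fanin C * circuit_size C.
Proof.
under eq_bigr do rewrite -sum1_card big_mkcond /=.
rewrite exchange_big /= mulnC -[X in _ <= X * _]card_ord -sum_nat_const.
apply: leq_sum => i _.
apply: leq_trans (gate_fanin_leq (m + i)).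
set src := gate_src (gate_of (m + i)).
have H t : (if i \in cut B t then 1 else 0) <=
    \sum_(u <- src) top_diff_digit B t (wire_depth u) (wire_depth (m + i)).
  rewrite (_ : (if _ then _ else _) = nat_of_bool (i \in cut B t)); last by case: ifP.
  by rewrite inE; exact: has_leq_sum.
apply: leq_trans (leq_sum _ (fun (t : 'I_p) _ => H t)) _.
rewrite exchange_big /=.
apply: leq_trans (leq_sum _ (fun u _ => sum_top_diff_digit B p _ _)) _.
by rewrite sum1_size size_tuple.
Qed.

(** Averaging: the smallest of the [p] cuts is no larger than their mean. *)
Lemma exists_small_cut B p : 0 < p ->
  exists2 t, t < p & p * #|cut B t| <= circuit_fanin C * circuit_size C.
Proof.
case: p => // p _.
have [t _ tmin] :=
  arg_minnP (fun t : 'I_p.+1 => #|cut B t|) (erefl true : xpredT ord0).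
exists t => //; apply: leq_trans (sum_card_cut B p.+1).
rewrite -[X in X * _]card_ord -sum_nat_const; apply: leq_sum => s _; exact: tmin.
Qed.
End Wires.

(** * From circuits to data structures *)

(** The answer takes any input consistent with the advice and the probed blocks and evaluates [f]
    there. The true input is consistent, so such an input exists, and determinacy makes the block
    correct. *)
Lemma data_structure_of_determined n b (f : (n * b).-tuple bool -> (n * b).-tuple bool)
    a (pre : (n * b).-tuple bool -> a.-tuple bool) (probes : 'I_n -> {set 'I_n}) :
  (forall x x' j, pre x = pre x' ->
     (forall i, i \in probes j -> block x i = block x' i) ->
     block (f x) j = block (f x') j) ->
  exists D : data_structure n b, [/\ ds_advice_size D = a,
    ds_query_complexity D = \max_(j < n) #|probes j| &
    forall x j, ds_query D x j = block (f x) j].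
Proof.
move=> det.
pose consistent j (s : a.-tuple bool) (g : {i : 'I_n | i \in probes j} -> b.-tuple bool) :=
  [set x | pre x = s /\ forall i, block x (val i) = g i]%classic.
exists (@DataStructure n b a pre probes (fun j s g =>
  block (f (xget (nseq_tuple _ false) (consistent j s g))) j)); split=> // x j.
rewrite /ds_query /=; set P := consistent _ _ _; apply: det.
  by have [] : P (xget (nseq_tuple _ false) P) by apply: (@xgetI _ _ P x); split.
move=> i ij; have [_] : P (xget (nseq_tuple _ false) P) by apply: (@xgetI _ _ P x); split.
by move=> /(_ (exist _ i ij)).
Qed.

Lemma eq_block_nth n b (x x' : (n * b).-tuple bool) (i : 'I_n) w :
  0 < b -> w %/ b = i -> block x i = block x' i -> nth false x w = nth false x' w.
Proof.
move=> b0 wi E; have wb : w %% b < b by rewrite ltn_mod.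
have := congr1 (fun z => tnth z (Ordinal wb)) E.
by rewrite !tnth_mktuple /= -wi -divn_eq.
Qed.

Lemma card_ord_mem_leq n (s : seq nat) : #|[set i : 'I_n | val i \in s]| <= size s.
Proof.
rewrite cardE -(size_map val); apply: uniq_leq_size.
  by rewrite map_inj_uniq ?enum_uniq //; exact: val_inj.
by move=> _ /mapP[i + ->]; rewrite mem_enum inE.
Qed.

Section CircuitDataStructure.
Variables (n b : nat) (C : circuit (n * b) (n * b)).
Variable f : (n * b).-tuple bool -> (n * b).-tuple bool.
Hypothesis C_f : circuit_computes C f.

(** Probes every block; meant for the finitely many [n] at which the asymptotic bounds do not hold
    yet. *)
Lemma trivial_data_structure :
  exists D : data_structure n b, forall x j, ds_query D x j = block (f x) j.
Proof.
have [|D [_ _ HD]] := @data_structure_of_determined n b f 0 (fun=> [tuple])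
  (fun=> [set: 'I_n]); last by exists D.
move=> x x' j _ H; congr (block (f _) j); apply: eq_from_tnth => w.
have b0 : 0 < b by case: b w => // -[w]; rewrite muln0.
have wn : w %/ b < n by rewrite ltn_divLR.
rewrite !(tnth_nth false); apply: (@eq_block_nth _ _ _ _ (Ordinal wn)) => //.
by apply: H; rewrite inE.
Qed.

(** Depth reduction for a single circuit. Only the positions [t < trunc_log B D] compete for the
    cut, which ensures [B ^ t.+1 <= D] in the bound on the deleted depth. The factor [b] counts the
    output bits of one block. *)
Lemma circuit_data_structure F D B : 1 < B -> B <= D -> 0 < F ->
  circuit_fanin C <= F -> circuit_depth C <= D ->
  exists S : data_structure n b,
    [/\ trunc_log B D * ds_advice_size S <= F * circuit_size C,
        ds_query_complexity S <= b * F ^ ((2 * D) %/ B) &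
        forall x j, ds_query S x j = block (f x) j].
Proof.
move=> B1 BD F0 CF CD; have B0 := ltnW B1; have D0 : 0 < D := leq_trans B0 BD.
have p0 : 0 < trunc_log B D by rewrite trunc_log_gt0 B1 prednK.
have [t tp cutP] := exists_small_cut C B p0.
set h := (2 * D) %/ B.
pose out (j : 'I_n) (l : 'I_b) : nat := nth 0 (map val (circuit_out C)) (j * b + l).
pose reads j := flatten [seq uncut_inputs C B t h (out j l) | l <- enum 'I_b].
pose pre x := map_tuple (fun i => wire_value C x (n * b + val i)) (enum_tuple (cut C B t)).
(* Input bit [w] lies in block [w %/ b]. *)
pose probes j := [set i : 'I_n | val i \in [seq w %/ b | w <- reads j]].
have [|S [aS qS HS]] := @data_structure_of_determined n b f _ pre probes; last first.
  exists S; split=> //.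
    by rewrite aS; apply: leq_trans cutP _; rewrite leq_mul2r CF orbT.
  rewrite qS; apply/bigmax_leqP => j _; apply: leq_trans (card_ord_mem_leq _ _) _.
  rewrite size_map size_flatten /shape -map_comp sumnE big_map.
  rewrite big_enum -[X in _ <= X * _]card_ord -sum_nat_const /=.
  by apply: leq_sum => l _; exact: size_uncut_inputs.
move=> x x' j Epre Eprobes; apply: eq_from_tnth => l; rewrite !tnth_mktuple.
have lt_jl : j * b + l < n * b.
  apply: (@leq_trans (j.+1 * b)); first by rewrite mulSn addnC ltn_add2r.
  by rewrite leq_mul2r ltn_ord orbT.
have out_val : out j l = tnth (circuit_out C) (Ordinal lt_jl).
  rewrite (tnth_nth (tnth (circuit_out C) (Ordinal lt_jl))) /out.
  by rewrite (nth_map (tnth (circuit_out C) (Ordinal lt_jl))) ?size_tuple.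
have Eout y : nth false (f y) (j * b + l) = wire_value C y (out j l).
  by rewrite -C_f -(tnth_nth false _ (Ordinal lt_jl)) tnth_mktuple out_val.
rewrite !Eout; apply: (@wire_value_determined _ _ C B t h) => //.
- by rewrite out_val ltn_ord.
- apply: delete_digit_leq => //.
    apply: leq_trans CD; rewrite out_val.
    exact: (leq_bigmax (F := fun i => nth 0 (wire_depths C) (tnth (circuit_out C) i))).
  by apply: leq_trans (trunc_logP B1 D0); rewrite leq_exp2l.
- move=> i icut; have := congr1 val Epre => /= /eq_in_map; apply.
  by rewrite mem_enum.
move=> w wr; have wm := uncut_inputs_ltn wr.
have b0 : 0 < b := leq_ltn_trans (leq0n l) (ltn_ord l).
have wn : w %/ b < n by rewrite ltn_divLR.
apply: (@eq_block_nth _ _ _ _ (Ordinal wn)) => //; apply: Eprobes.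
rewrite inE; apply/mapP; exists w => //; apply/flattenP.
by exists (uncut_inputs C B t h (out j l)) => //; apply: map_f; rewrite mem_enum.
Qed.
End CircuitDataStructure.

(** The crude [F < 2 ^ F] bounds the left side by a power of 2 with exponent [h * F * Q]; rounding
    the logarithm up costs at most the factor 2. *)
Lemma expn_expn_le_double (F h Q n : nat) : 1 < n -> h * F * Q <= blog n ->
  (F ^ h) ^ Q <= 2 * n.
Proof.
move=> n1 hFQ; have /andP[ltn _] := @up_log_bounds 2 n isT n1.
have b0 : 0 < blog n by rewrite up_log_gt0.
apply: (@leq_trans (2 ^ blog n)); last first.
  by rewrite -(prednK b0) expnS leq_mul2l ltnW.
apply: (@leq_trans (2 ^ (h * F * Q))); last by rewrite leq_exp2l.
have leX e m1 m2 : m1 <= m2 -> m1 ^ e <= m2 ^ e.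
  by case: e => // e; rewrite leq_exp2r.
by rewrite [h * F]mulnC !expnM; apply: (leX); apply: (leX); exact/ltnW/ltn_expl.
Qed.

(** * Asymptotics *)

Import Order.TTheory GRing.Theory Num.Theory.
Local Open Scope ring_scope.
Local Open Scope classical_set_scope.

Section Asymptotics.
Variable R : realType.

Let ln2_gt0 : 0 < ln 2 :> R.
Proof. by rewrite ln_gt0 // ltr1n. Qed.

Lemma log2_le_blog n : (0 < n)%N -> log2 n%:R <= (blog n)%:R :> R.
Proof.
move=> n0; rewrite /log2 ler_pdivrMr // mulr_natl -lnXn // ler_ln ?posrE ?ltr0n //.
by rewrite -natrX ler_nat up_logP.
Qed.

(** Rounding up adds at most 1, which is itself at most the logarithm of [n]. *)
Lemma blog_le_log2 n : (1 < n)%N -> (blog n)%:R <= 2 * log2 n%:R :> R.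
Proof.
move=> n1; have /andP[ltn _] := @up_log_bounds 2 n isT n1.
have b0 : (0 < blog n)%N by rewrite up_log_gt0.
have log_ge p : (2 ^ p <= n)%N -> p%:R <= log2 n%:R :> R.
  move=> pn; rewrite /log2 ler_pdivlMr // mulr_natl -lnXn // ler_ln ?posrE ?exprn_gt0 //.
    by rewrite -natrX ler_nat.
  by rewrite ltr0n ltnW.
rewrite -(prednK b0) -natr1 mulr2n mulrDl !mul1r lerD //; first exact/log_ge/ltnW.
exact: (log_ge 1%N).
Qed.

Lemma le_powR_of_expn (s n Q : nat) (e : R) : (0 < n)%N -> (0 < Q)%N ->
  Q%:R^-1 <= e -> (s ^ Q <= 2 * n)%N -> s%:R <= 2 * n%:R `^ e.
Proof.
move=> n0 Q0 Qe sQ.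
have Qn0 : Q%:R != 0 :> R by rewrite pnatr_eq0 -lt0n.
have -> : s%:R = (s%:R ^+ Q) `^ Q%:R^-1 :> R.
  by rewrite -powR_mulrn // -powRrM mulfV // powRr1.
apply: (@le_trans _ _ ((2 * n%:R) `^ Q%:R^-1)).
  apply: ge0_ler_powR; rewrite ?nnegrE ?invr_ge0 ?exprn_ge0 ?mulr_ge0 //.
  by rewrite -natrX -natrM ler_nat.
rewrite powRM //; apply: ler_pM; rewrite ?powR_ge0 //.
  by apply: ler1_powR; rewrite ?ler1n // invf_le1 ?ltr0n // ler1n.
by apply: ler_powR; rewrite ?ler1n.
Qed.

Lemma log2_le_powR n (e : R) : (0 < n)%N -> 0 < e ->
  log2 n%:R <= (e * ln 2)^-1 * n%:R `^ e.
Proof.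
move=> n0 e0; rewrite /log2 invfM -mulrA [X in _ <= _ * X]mulrC mulrA.
rewrite ler_pM2r ?invr_gt0 // mulrC ler_pdivlMr // mulrC -ln_powR.
by apply/ltW/ln_sublinear; rewrite powR_gt0 // ltr0n.
Qed.

(** One half of the exponent [e] absorbs the factor [blog n], the other half absorbs [s]. *)
Lemma query_bound (s n Q : nat) (e : R) : (1 < n)%N -> (0 < Q)%N -> 0 < e ->
  Q%:R^-1 <= e / 2 -> (s ^ Q <= 2 * n)%N ->
  (blog n * s)%:R <= 8 / (e * ln 2) * n%:R `^ e.
Proof.
move=> n1 Q0 e0 Qe sQ; have n0 := ltnW n1.
have e20 : 0 < e / 2 by rewrite divr_gt0.
have -> : n%:R `^ e = n%:R `^ (e / 2) * n%:R `^ (e / 2).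
  by rewrite -powRD -?splitr //; apply/implyP; rewrite pnatr_eq0 -lt0n.
have -> : 8 / (e * ln 2) = (2 * (e / 2 * ln 2)^-1) * 2.
  by field; rewrite ?gt_eqF.
rewrite natrM mulrACA; apply: ler_pM => //; last exact: le_powR_of_expn Qe sQ.
apply: le_trans (blog_le_log2 n1) _; rewrite -[leRHS]mulrA ler_pM2l //.
exact: log2_le_powR.
Qed.

(** Here [p] counts digit positions. As [p.+1 <= 2 * p], the iterated logarithm of [n] is at most
    [2 * p] times that of [B], so dividing by [p] gains it. The other factor 2 in the constant 4
    pays for the rounding in [blog]. *)
Lemma advice_bound (a p n B K : nat) : (4 < n)%N -> (0 < p)%N -> (1 < B)%N ->
  (blog n <= B ^ p.+1)%N -> (p * a <= K * (n * blog n))%N ->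
  a%:R <= (4 * K%:R * (ln B%:R / ln 2)) * (n%:R * log2 n%:R / log2 (log2 n%:R)) :> R.
Proof.
move=> n4 p0 B1 bB pa; have n1 : (1 < n)%N by apply: leq_trans n4.
have lnB : 0 < ln B%:R :> R by rewrite ln_gt0 // ltr1n.
have log_gt1 : 1 < log2 n%:R :> R.
  rewrite /log2 ltr_pdivlMr // mul1r ltr_ln ?posrE ?ltr0n ?(ltnW n1) //.
  by rewrite ltr_nat (leq_trans _ n4).
have log_gt0 : 0 < log2 n%:R :> R := lt_trans ltr01 log_gt1.
have l_gt0 : 0 < log2 (log2 n%:R) :> R by rewrite {1}/log2 divr_gt0 // ln_gt0.
have l_le : log2 (log2 n%:R) <= 2 * p%:R * (ln B%:R / ln 2) :> R.
  rewrite {1}/log2 mulrA ler_pM2r ?invr_gt0 //.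
  apply: (@le_trans _ _ (ln (B%:R ^+ (2 * p)))).
    rewrite ler_ln ?posrE ?exprn_gt0 ?ltr0n ?(ltnW B1) //.
    apply: le_trans (log2_le_blog (ltnW n1)) _; rewrite -natrX ler_nat.
    by apply: leq_trans bB _; rewrite leq_exp2l // mul2n -addnn -addn1 leq_add2l.
  by rewrite lnXn ?ltr0n ?(ltnW B1) // -[leLHS]mulr_natl natrM.
rewrite mulrA ler_pdivlMr //.
apply: (@le_trans _ _ (a%:R * (2 * p%:R * (ln B%:R / ln 2)))).
  by rewrite ler_wpM2l.
have -> : a%:R * (2 * p%:R * (ln B%:R / ln 2)) = 2 * (ln B%:R / ln 2) * (p * a)%:R :> R.
  by rewrite natrM; ring.
have -> : 4 * K%:R * (ln B%:R / ln 2) * (n%:R * log2 n%:R) =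
    2 * (ln B%:R / ln 2) * (K%:R * (n%:R * (2 * log2 n%:R))) :> R by ring.
rewrite ler_pM2l ?mulr_gt0 ?invr_gt0 //.
apply: (@le_trans _ _ (K * (n * blog n))%:R); first by rewrite ler_nat.
by rewrite !natrM ler_wpM2l // ler_wpM2l // blog_le_log2.
Qed.
End Asymptotics.

(** Passes to an integer constant, since the construction for a single circuit takes natural numbers
    as parameters. *)
Lemma eventually_nat_le (R : realType) (u g : nat -> nat) (v : nat -> R) :
  (forall n, (0 < n)%N -> 0 <= v n <= (g n)%:R) ->
  (fun n => (u n)%:R : R) =O_\oo v ->
  exists2 M : nat, (0 < M)%N & \forall n \near \oo, (u n <= M * g n)%N.
Proof.
move=> Hv /eqO_exP[c c0 Hc]; exists (Num.bound c).+1 => //.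
near=> n; have n0 : (0 < n)%N by near: n; exact: nbhs_infty_gt.
have /andP[v0 vg] := Hv n n0.
have : `|(u n)%:R : R| <= c * `|v n| by near: n.
rewrite normr_nat ger0_norm // => /le_trans H; rewrite -(ler_nat R) natrM.
apply: H; apply: ler_pM => //; first exact: ltW.
by apply: le_trans (ltW (archi_boundP (ltW c0))) _; rewrite ler_nat.
Unshelve. all: by end_near. Qed.

Theorem theorem8 (R : realType)
  (f : forall n : nat, (n * blog n).-tuple bool -> (n * blog n).-tuple bool)
  (C : forall n : nat, circuit (n * blog n) (n * blog n))
  (k : nat)
  (C_fanin : forall n : nat, (circuit_fanin (C n) <= k)%N)
  (C_size : (fun n : nat => (circuit_size (C n))%:R : R)
     =O_\oo (fun n : nat => n%:R * log2 n%:R : R))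
  (C_depth : (fun n : nat => (circuit_depth (C n))%:R : R)
     =O_\oo (fun n : nat => log2 n%:R : R))
  (C_f : forall n : nat, circuit_computes (C n) (@f n))
  (eps : R) (eps_gt0 : 0 < eps) :
  exists D : forall n : nat, data_structure n (blog n),
    [/\ (fun n : nat => (ds_advice_size (D n))%:R : R)
          =O_\oo (fun n : nat => n%:R * log2 n%:R / log2 (log2 n%:R) : R),
        (fun n : nat => (ds_query_complexity (D n))%:R : R)
          =O_\oo (fun n : nat => n%:R `^ eps : R)
      & forall (n : nat) (x : (n * blog n).-tuple bool) (j : 'I_n),
          ds_query (D n) x j = block (f n x) j].
Proof.
have log_bounds n : (0 < n)%N -> 0 <= (log2 n%:R : R) <= (blog n)%:R.
  move=> n0; rewrite log2_le_blog // andbT divr_ge0 ?ln_ge0 ?ler1n //.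
have [MS MS0 sizeP] : exists2 M : nat, (0 < M)%N & \forall n \near \oo,
    (circuit_size (C n) <= M * (n * blog n))%N.
  apply: eventually_nat_le C_size => n /log_bounds/andP[l0 lb].
  by rewrite natrM mulr_ge0 //= ler_wpM2l.
have [M M0 depthP] : exists2 M : nat, (0 < M)%N & \forall n \near \oo,
    (circuit_depth (C n) <= M * blog n)%N.
  exact: eventually_nat_le C_depth.
pose F := k.+1.
(* Makes [1 / Q] at most [eps / 2]; the rest of the exponent is kept for the factor [blog n]. *)
pose Q := (Num.bound (2 / eps)).+1.
have QP : Q%:R^-1 <= eps / 2.
  rewrite -[eps / 2]invrK lef_pV2 ?posrE ?invr_gt0 ?divr_gt0 // invf_div.
  apply: le_trans (ltW (archi_boundP _)) _; first by rewrite divr_ge0 // ltW.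
  by rewrite ler_nat.
(* Chosen so that [F ^ (2 * D %/ B)] is at most about [n ^ (1 / Q)] for [D = M * blog n]. *)
pose B := (2 * F * M * Q)%N.
have B1 : (1 < B)%N by rewrite /B -!mulnA leq_pmulr // !muln_gt0 M0.
pose good n := [&& (4 < n)%N, (B <= M * blog n)%N,
  (circuit_size (C n) <= MS * (n * blog n))%N & (circuit_depth (C n) <= M * blog n)%N].
have goodP : \forall n \near \oo, good n.
  near=> n; apply/and4P; split; [near: n; exact: nbhs_infty_gt | | by near: n | by near: n].
  (* Cancelling [M] leaves [2 * F * Q <= blog n], true once [n] is at least [2 ^ (2 * F * Q)]. *)
  rewrite /B mulnAC [(_ * M)%N]mulnC leq_mul2l; apply/orP; right.
  rewrite -(@leq_exp2l 2) //.
  by apply: leq_trans (up_logP n _) => //; near: n; exact: nbhs_infty_ge.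
have ex_D n : exists D : data_structure n (blog n),
    (forall x j, ds_query D x j = block (f n x) j) /\ (good n ->
      (ds_advice_size D)%:R <= 4 * (F * MS)%:R * (ln B%:R / ln 2) *
         (n%:R * log2 n%:R / log2 (log2 n%:R)) :> R /\
      (ds_query_complexity D)%:R <= 8 / (eps * ln 2) * n%:R `^ eps).
  have [/and4P[n4 BD sizeC depthC]|_] := boolP (good n); last first.
    by have [D HD] := trivial_data_structure (f n); exists D; split.
  have [D [aD qD HD]] := circuit_data_structure (C_f n) B1 BD (ltn0Sn k)
    (leqW (C_fanin n)) depthC.
  exists D; split=> // _; split.
    apply: (@advice_bound _ _ (trunc_log B (M * blog n))) => //.
    - by rewrite trunc_log_gt0 B1 /= (prednK (ltnW B1)).
    - apply: leq_trans (ltnW (trunc_log_ltn _ B1)); exact: leq_pmull.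
    - by apply: leq_trans aD _; rewrite -mulnA leq_mul2l sizeC orbT.
  have n1 : (1 < n)%N by apply: leq_trans n4.
  apply: (@le_trans _ _ (blog n * F ^ ((2 * (M * blog n)) %/ B))%:R).
    by rewrite ler_nat.
  apply: (query_bound n1 (ltn0Sn _) eps_gt0 QP).
  apply: expn_expn_le_double => //.
  (* The quotient [h] satisfies [h * B <= 2 * M * blog n]; the factor [2 * M] of [B] cancels and
     leaves [h * F * Q <= blog n]. *)
  rewrite -(@leq_pmul2l (2 * M)) ?muln_gt0 //.
  move: (_ %/ B)%N (leq_divM (2 * (M * blog n)) B) => h.
  by rewrite /B; nia.
exists (fun n => projT1 (cid (ex_D n))); split.
- apply/eqO_exP; exists (4 * (F * MS)%:R * (ln B%:R / ln 2)).
    by rewrite !mulr_gt0 ?invr_gt0 ?ln_gt0 ?ltr1n ?ltr0n ?muln_gt0.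
  near=> n; rewrite normr_nat.
  have [_ /(_ _)[|aD _]] := projT2 (cid (ex_D n)); first by near: n.
  apply: le_trans aD _; rewrite ler_wpM2l ?ler_norm //.
  by rewrite !mulr_ge0 ?invr_ge0 ?ln_ge0 ?ler1n // ltnW.
- apply/eqO_exP; exists (8 / (eps * ln 2)).
    by rewrite divr_gt0 // mulr_gt0 // ln_gt0 // ltr1n.
  near=> n; rewrite normr_nat ger0_norm ?powR_ge0 //.
  by have [_ /(_ _)[|_ qD]] := projT2 (cid (ex_D n)); first by near: n.
- by move=> n; have [] := projT2 (cid (ex_D n)).
Unshelve. all: by end_near. Qed.
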